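(* Let $\mathbb{X}$ be a real Banach space possessing an unconditional Schauder basis $(\mathbf d_l)_{l\in\mathbb N}$ and let $\mathcal K$ be its unconditional basis constant. Let $k\in\mathbb N$ and $\bm\alpha=(\alpha_l)_{l\in\mathbb N}$ with $\alpha_l\in(0,1)$ for every $l$. The component-wise quantile $\mathbf q_{S,\bm\alpha}$ exists, is unique, and is Lipschitz continuous: for every $\mathbf x_1,\dots,\mathbf x_k,\mathbf z_1,\dots,\mathbf z_k\in\mathbb X$, $$\|\mathbf q_{S,\bm\alpha}(\mathbf x_1,\dots,\mathbf x_k)-\mathbf q_{S,\bm\alpha}(\mathbf z_1,\dots,\mathbf z_k)\|_{\mathbb X}\le\mathcal K^2\|(\mathbf x_1,\dots,\mathbf x_k)-(\mathbf z_1,\dots,\mathbf z_k)\|_{\mathbb X^k},$$ and if $\mathbb X$ is a Hilbert space then $$\|\mathbf q_{S,\bm\alpha}(\mathbf x_1,\dots,\mathbf x_k)-\mathbf q_{S,\bm\alpha}(\mathbf z_1,\dots,\mathbf z_k)\|_{\mathbb X}\le\sqrt{\sum_{i=1}^k\|\mathbf x_i-\mathbf z_i\|_{\mathbb X}^2}\le\|(\mathbf x_1,\dots,\mathbf x_k)-(\mathbf z_1,\dots,\mathbf z_k)\|_{\mathbb X^k}.$$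
   Context: Univariate quantile: for $\alpha\in(0,1)$ and $\mathbf x\in\mathbb R^k$ with increasingly ordered components $\tilde x_1\le\dots\le\tilde x_k$, $q_\alpha(\mathbf x)=\frac12(\tilde x_{\lceil k\alpha\rceil}+\tilde x_{\lfloor k\alpha+1\rfloor})$. A Schauder basis is unconditional if every convergent series $\sum_l x_l\mathbf d_l$ converges unconditionally. For $\mathbf x_i=\sum_{l\in\mathbb N}x_i^{(l)}\mathbf d_l$, $i=1,\dots,k$, the component-wise quantile with respect to the Schauder basis is $\mathbf q_{S,\bm\alpha}(\mathbf x_1,\dots,\mathbf x_k)=\sum_{l\in\mathbb N}q_{\alpha_l}(x_1^{(l)},\dots,x_k^{(l)})\,\mathbf d_l$; its existence means that this series defines an element of $\mathbb X$. Unconditional basis constant: $\mathcal K=\sup\{\|\sum_{l\in F}\epsilon_l x_l\mathbf d_l\|_{\mathbb X}: F\subset\mathbb N,\ \epsilon_l=\pm1,\ \mathbf x=\sum_l x_l\mathbf d_l,\ \|\mathbf x\|_{\mathbb X}=1\}$, which equals the same supremum with real multipliers $|\lambda_l|\le1$ in place of the signs $\epsilon_l$. The norm on $\mathbb X^k$ is $\|(\mathbf x_1,\dots,\mathbf x_k)\|_{\mathbb X^k}=\sum_{i=1}^k\|\mathbf x_i\|_{\mathbb X}$.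
   Formalization: In the Hilbert space clause the basis is additionally assumed orthogonal; for a general unconditional basis of a Hilbert space the bound with constant 1 is false (e.g. basis e_0, e_0 + t e_1, e_2, … of l^2 with 0 < t < 1, and the componentwise minimum). *)

(* Defs.v *)
From HB Require Import structures.
From mathcomp Require Import all_boot all_order all_algebra.
From mathcomp Require Import all_classical all_reals all_analysis.

Set Implicit Arguments.
Unset Strict Implicit.
Unset Printing Implicit Defensive.

Import Order.TTheory GRing.Theory Num.Theory.
Import numFieldNormedType.Exports.

Local Open Scope classical_set_scope.
Local Open Scope ring_scope.

Section Quantile.
Variables (R : realType) (k : nat).

(* The rank [j] is counted from 1; it is out of range when [j = 0] or
   [j > k], which never happens in [quantile] for [0 < k] and [0 < a < 1]. *)
Definition order_stat (x : 'I_k -> R) (j : nat) : R :=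
  nth 0 (sort <=%R (codom x)) j.-1.

(* [Num.ceil] and [Num.floor] are integers, nonnegative here, and [absz]
   turns them into natural numbers. *)
Definition quantile (a : R) (x : 'I_k -> R) : R :=
  (order_stat x (absz (Num.ceil (k%:R * a))) +
   order_stat x (absz (Num.floor (k%:R * a + 1)))) / 2.

End Quantile.

Section SchauderBasis.
Variables (R : realType) (X : completeNormedModType R).
Implicit Types (d : nat -> X) (c : nat -> R) (x : X).

Definition expansion d c x : Prop :=
  series (fun l => c l *: d l) @ \oo --> x.

Definition schauder_basis d : Prop := forall x, exists! c, expansion d c x.

Definition unconditionally_convergent (u : nat -> X) : Prop :=
  forall s : nat -> nat, bijective s -> cvgn (series (u \o s)).

Definition unconditional_schauder_basis d : Prop :=
  schauder_basis d /\
  forall c, cvgn (series (fun l => c l *: d l)) ->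
    unconditionally_convergent (fun l => c l *: d l).

(* The subset [F] of the indices may be infinite. For an unconditional basis
   the set below is nonempty and bounded, so [sup] is its actual supremum. *)
Definition unconditional_constant d : R :=
  sup [set r | exists (F : set nat) (e : nat -> R) (c : nat -> R) (x y : X),
    [/\ forall l, e l = 1 \/ e l = -1,
        expansion d c x,
        `|x| = 1,
        expansion d (fun l => \1_F l * e l * c l) y
      & r = `|y| ] ].

(* [q] is the componentwise quantile of [x]: the series with coefficients
   [quantile (a l) (x_1^(l), ..., x_k^(l))] converges to [q]. *)
Definition is_componentwise_quantile d k (a : nat -> R) (x : 'I_k -> X)
    (q : X) : Prop :=
  exists c : 'I_k -> nat -> R,
    (forall i, expansion d (c i) (x i)) /\
    expansion d (fun l => quantile (a l) (fun i => c i l)) q.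

Definition norm_pow k (x : 'I_k -> X) : R := \sum_(i < k) `|x i|.

(* As [X] is complete, such an inner product makes it a Hilbert space. *)
Definition induces_norm (ip : {dot X for idfun}) : Prop :=
  forall x, `|x| = Num.sqrt (ip x x).

(* Needed for Lipschitz constant 1 in a Hilbert space: in l^2 with the basis
   d_0 = e_0, d_1 = e_0 + t e_1, d_l = e_l (l >= 2), the componentwise minimum
   of d_1 - d_0 = t e_1 and 0 is - d_0, of norm 1, however small t > 0 is.
   Orthonormal bases are a special case. *)
Definition orthogonal_family (ip : {dot X for idfun}) d : Prop :=
  forall l m, l != m -> ip (d l) (d m) = 0.

End SchauderBasis.

(* Main.v *)
Require Import Defs.
From HB Require Import structures.
From mathcomp Require Import all_boot all_order all_algebra.
From mathcomp Require Import all_classical all_reals all_analysis.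
From mathcomp Require Import ring lra.

Set Implicit Arguments.
Unset Strict Implicit.
Unset Printing Implicit Defensive.

Import Order.TTheory GRing.Theory Num.Theory.
Import numFieldNormedType.Exports.

Local Open Scope classical_set_scope.
Local Open Scope ring_scope.

(** The quantile of [k] reals is nonexpansive for the maximum norm: raising
    every entry by at most [m] raises every order statistic by at most [m]
    ([le_order_stat], [quantile_dist_le]).  Hence each coefficient of the
    difference of two componentwise quantiles is at most the sum over [i] of
    the absolute coefficients of [x i - z i].  A sequence dominated in this way
    is a sum over [i] of the coefficients of [x i - z i] multiplied by numbers
    in [-1, 1].  Bounded multipliers preserve the convergence of an
    unconditionally convergent series ([cvg_multiplier]), and they increase the
    norm at most by the factor [K], the unconditional constant
    ([multiplier_bound_constant]).  This gives existence and the Lipschitz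
    constant [K] ([dominated_expansion]), and [K <= K ^+ 2] as [1 <= K].

    Unconditional convergence is stated by permutations.  If finite sums of
    terms of arbitrarily large indices did not become small, a permutation
    moving such sums to the front of consecutive blocks of indices would give a
    divergent series ([unconditional_finite_sums]); sums with signs are
    differences of two such sums, and sums with multipliers in [-1, 1] are
    convex combinations of sums with signs ([norm_sum_multiplier_le]).

    As [K] is the supremum of a set of reals, its use requires that the set is
    bounded.  This is an instance of the open mapping theorem: the least
    multiplier bound of the coefficients of [x] is a norm, finite at each vector
    and at least the given norm, for which the space is complete (see
    [multiplier_bound_lim]).  Baire's theorem ([multiplier_bound_dense]) and
    successive approximation ([multiplier_bound_linear]) then show that it is at
    most a constant multiple of the given norm.

    For an orthogonal basis the squared norm of a partial sum is the sum of the
    squares of its terms ([pythagoras]), so the inequality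
    [quantile_dist_sqr] between squared coefficients sums up to the Lipschitz
    constant 1. *)

(** * Quantiles are nonexpansive for the maximum norm *)

Section QuantileLipschitz.
Variables (R : realType) (k : nat).
Implicit Types (x z : 'I_k -> R) (m : R).

(** A number [t] bounds the [n]-th smallest entry, counted from 0, exactly when
    more than [n] entries are at most [t]; entries of [z] that are at most [t]
    give entries of [x] that are at most [t + m]. *)
Lemma le_order_stat x z m j : 0 <= m -> (forall i, x i <= z i + m) ->
  order_stat x j <= order_stat z j + m.
Proof.
move=> m0 xz; rewrite /order_stat; set n := j.-1.
have [kn|nk] := leqP k n.
  by rewrite !nth_default ?size_sort ?size_codom ?card_ord// add0r.
set t := nth 0 (sort _ (codom z)) n.
have szs : (n < size (sort <=%R (codom z)))%N.
  by rewrite size_sort size_codom card_ord.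
have sz : sorted <=%O (sort <=%R (codom z)) by exact: sort_le_sorted.
have sx : sorted <=%O (sort <=%R (codom x)) by exact: sort_le_sorted.
apply: nth_count_le => //.
apply: (@leq_trans (count (fun y => y <= t) (sort <=%R (codom z)))).
  rewrite ltnNge; apply/negP => ct.
  have : t < nth 0 (sort <=%R (codom z)) n.
    by apply: nth_count_gt => //; rewrite ct.
  by rewrite ltxx.
rewrite !(permP (permEl (perm_sort _ _))) /codom !count_map.
by apply: sub_count => i /= zt; rewrite (le_trans (xz i))// lerD2r.
Qed.

Lemma quantile_dist_le a x z m : 0 <= m -> (forall i, `|x i - z i| <= m) ->
  `|quantile a x - quantile a z| <= m.
Proof.
move=> m0 xz.
have d j : `|order_stat x j - order_stat z j| <= m.
  have xzP i : x i <= z i + m /\ z i <= x i + m.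
    by have := xz i; rewrite ler_norml => /andP[? ?]; split; lra.
  have := @le_order_stat x z m j m0 (fun i => (xzP i).1).
  have := @le_order_stat z x m j m0 (fun i => (xzP i).2).
  by rewrite ler_norml => ? ?; apply/andP; split; lra.
rewrite /quantile; set i1 := absz _; set i2 := absz _.
have := d i1; have := d i2; rewrite !ler_norml => /andP[? ?] /andP[? ?].
by apply/andP; split; lra.
Qed.

Lemma quantile0 a : quantile a ((fun=> 0) : 'I_k -> R) = 0.
Proof.
have o j : order_stat ((fun=> 0) : 'I_k -> R) j = 0.
  rewrite /order_stat; set s := sort _ _.
  have [ns|sn] := ltnP j.-1 (size s); last by rewrite nth_default.
  by have := mem_nth 0 ns; rewrite mem_sort => /codomP[i ->].
by rewrite /quantile !o addr0 mul0r.
Qed.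

Lemma quantile_dist_sum a x z :
  `|quantile a x - quantile a z| <= \sum_i `|x i - z i|.
Proof.
apply: quantile_dist_le => [|i]; first exact: sumr_ge0.
by rewrite (bigD1 i)//= lerDl sumr_ge0.
Qed.

Lemma quantile_dist_sqr a x z :
  (quantile a x - quantile a z) ^+ 2 <= \sum_i (x i - z i) ^+ 2.
Proof.
have s0 : 0 <= \sum_i (x i - z i) ^+ 2 by apply: sumr_ge0 => i _; exact: sqr_ge0.
rewrite -(sqr_sqrtr s0) -(real_normK (num_real _)) lerXn2r ?nnegrE//.
apply: quantile_dist_le => // i; rewrite -sqrtr_sqr ler_wsqrtr//.
by rewrite (bigD1 i)//= lerDl sumr_ge0// => *; exact: sqr_ge0.
Qed.

End QuantileLipschitz.

(** * Bounded multipliers of unconditionally convergent series *)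

(** Finite rearrangements that extend one another glue to a rearrangement of
    the whole sequence; its value at [i] can be read off any of the lists that
    is long enough, for instance [P i.+1]. *)
Lemma bijective_of_prefixes (P : nat -> seq nat) (N : nat -> nat) :
  (forall j, prefix (P j) (P j.+1)) ->
  (forall j, perm_eq (P j) (iota 0 (N j))) -> (forall j, (j <= N j)%N) ->
  exists2 s : nat -> nat, bijective s & forall j, map s (iota 0 (N j)) = P j.
Proof.
move=> pP permP leN.
have sizeP j : size (P j) = N j by rewrite (perm_size (permP j)) size_iota.
have uniqP j : uniq (P j) by rewrite (perm_uniq (permP j)) iota_uniq.
have memP j l : (l \in P j) = (l < N j)%N by rewrite (perm_mem (permP j)) mem_iota.
have prefP i j : (i <= j)%N -> prefix (P i) (P j).
  elim: j => [|j IH]; first by rewrite leqn0 => /eqP ->; exact: prefix_refl.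
  rewrite leq_eqVlt => /predU1P[->|/IH ij]; first exact: prefix_refl.
  exact: prefix_trans ij (pP j).
have nthP i j l : (l < N i)%N -> (l < N j)%N -> nth 0%N (P i) l = nth 0%N (P j) l.
  wlog ij : i j / (i <= j)%N => [H li lj|li _].
    by have [/H|/ltnW/H H'] := leqP i j; [exact|rewrite H'].
  have /prefixP[r ->] := prefP _ _ ij.
  by rewrite nth_cat sizeP li.
pose s n := nth 0%N (P n.+1) n; pose t m := index m (P m.+1).
have sE j l : (l < N j)%N -> s l = nth 0%N (P j) l.
  by move=> lj; rewrite /s; apply: nthP => //; exact: leN.
exists s; last first.
  move=> j; apply: (@eq_from_nth _ 0%N); rewrite size_map size_iota ?sizeP//.
  by move=> l lj; rewrite (nth_map 0%N) ?size_iota// nth_iota// add0n (sE j).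
exists t => n.
  pose J := (maxn n (s n)).+1.
  have nJ : (n < N J)%N by rewrite (leq_trans _ (leN _))// ltnS leq_maxl.
  have /prefixP[r rE] : prefix (P (s n).+1) (P J).
    by apply: prefP; rewrite ltnS leq_maxr.
  have -> : t (s n) = index (s n) (P J).
    by rewrite /t rE index_cat memP leN.
  by rewrite (sE J n nJ) index_uniq// sizeP.
rewrite (sE n.+1) ?nth_index ?memP ?leN//.
by rewrite -sizeP index_mem memP leN.
Qed.

Section Multipliers.
Variables (R : realType) (X : completeNormedModType R).
Implicit Types (u : nat -> X) (e lam : nat -> R).

(** Otherwise the indices could be cut into consecutive blocks, each of them
    starting, after a rearrangement of the block, with a finite sum of norm
    larger than [eps]; the rearranged series would not be Cauchy. *)
Lemma unconditional_finite_sums u (eps : R) :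
  unconditionally_convergent u -> 0 < eps ->
  exists N, forall s : seq nat, uniq s -> all (leq N) s ->
    `|\sum_(l <- s) u l| <= eps.
Proof.
move=> uu eps0; apply: contrapT => /forallNP noN.
have /choice[f fP] N : exists s : seq nat,
    [/\ uniq s, all (leq N) s & eps < `|\sum_(l <- s) u l|].
  have /existsNP[s /not_implyP[us /not_implyP[Ns /negP]]] := noN N.
  by rewrite -ltNge => epss; exists s.
(* A block starting at [N] ends before [next N], past all of [f N]; [P j] lists
   the first [j] blocks, each with [f] in front of its other indices. *)
pose next N := maxn N.+1 (\max_(l <- f N) l).+1.
pose N j := iter j next 0%N.
pose rest n := [seq l <- iota n (next n - n) | l \notin f n].
pose P := fix P j := if j is i.+1 then P i ++ (f (N i) ++ rest (N i)) else [::].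
have ltnext n : (n < next n)%N by rewrite leq_max ltnSn.
have leN j : (j <= N j)%N.
  by elim: j => // j IH; rewrite (leq_ltn_trans IH)//= ltnext.
have permP j : perm_eq (P j) (iota 0 (N j)).
  elim: j => // j IH.
  have -> : N j.+1 = (N j + (next (N j) - N j))%N by rewrite (subnKC (ltnW (ltnext _))).
  rewrite iotaD add0n /=; apply: perm_cat => //.
  have [uf Nf _] := fP (N j).
  apply: uniq_perm.
  - rewrite cat_uniq uf filter_uniq ?iota_uniq// andbT.
    by apply/hasPn => l; rewrite /rest mem_filter; case/andP.
  - exact: iota_uniq.
  move=> l; rewrite mem_cat /rest mem_filter mem_iota (subnKC (ltnW (ltnext _))).
  case: (boolP (l \in f (N j))) => //= lf; apply/esym/andP; split.
    exact: (allP Nf).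
  by rewrite leq_max ltnS [X in _ || X]ltnS (leq_bigmax_seq l) ?orbT.
have [s sbij sE] := @bijective_of_prefixes P N (fun j => prefix_prefix _ _) permP leN.
have /cauchy_cvgP/cauchy_seriesP/(_ _ eps0) := uu s sbij.
case=> -[A B] [[a _ aA] [b _ bB]] AB.
pose j := maxn a b; pose n := N j; pose m := (n + size (f n))%N.
have an : (a <= n)%N by rewrite (leq_trans _ (leN _))// leq_maxl.
have bm : (b <= m)%N by rewrite (leq_trans _ (leq_addr _ _))// (leq_trans _ (leN _))// leq_maxr.
have small := AB (n, m) (conj (aA _ an) (bB _ bm)).
have [_ _ large] := fP n.
suff E : \sum_(l <- f n) u l = \sum_(n <= k < m) (u \o s) k.
  by move: large; rewrite E ltNge ltW.
have <- : map s (iota n (size (f n))) = f n.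
  have := sE j.+1; rewrite [P j.+1]/= -(sE j) -/n.
  have -> : N j.+1 = (n + (next n - n))%N by rewrite (subnKC (ltnW (ltnext _))).
  rewrite iotaD map_cat add0n => /eqP; rewrite eqseq_cat// eqxx/= => /eqP E.
  have szf : (size (f n) <= next n - n)%N.
    by have := congr1 size E; rewrite size_map size_iota size_cat => ->; exact: leq_addr.
  move: E; rewrite -(subnKC szf) iotaD map_cat => /eqP.
  by rewrite eqseq_cat ?size_map ?size_iota// => /andP[/eqP].
by rewrite big_map /m /index_iota addKn.
Qed.

(** The norm is convex in each multiplier separately, hence maximal at signs. *)
Lemma norm_sum_multiplier_le n (v : X) u (B : R) :
  (forall e, (forall l, e l = 1 \/ e l = -1) ->
    `|v + \sum_(0 <= l < n) e l *: u l| <= B) ->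
  forall lam, (forall l, `|lam l| <= 1) ->
    `|v + \sum_(0 <= l < n) lam l *: u l| <= B.
Proof.
move=> + lam lam1; elim: n v => [|n IH] v H.
  by have := H (fun=> 1) (fun=> or_introl erefl); rewrite !big_geq.
rewrite big_nat_recr//=.
have bnd t : t = 1 \/ t = -1 ->
    `|(v + t *: u n) + \sum_(0 <= l < n) lam l *: u l| <= B.
  move=> t1; apply: IH => e e1.
  have := H (fun l => if l == n then t else e l).
  rewrite big_nat_recr//= eqxx -addrA [_ *: _ + _]addrC.
  under eq_big_nat => l ln do rewrite (ltn_eqF (andP ln).2).
  by apply=> l; case: ifP.
have := bnd 1 (or_introl erefl); have := bnd (-1) (or_intror erefl).
set w := \sum_(0 <= l < n) _; rewrite scaleN1r scale1r => Bm Bp.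
set a := lam n; have := lam1 n; rewrite -/a ler_norml => /andP[a1 a2].
have -> : v + (w + a *: u n) =
    ((1 - a) / 2) *: (v - u n + w) + ((1 + a) / 2) *: (v + u n + w).
  rewrite !(addrAC v _ w) addrA; move: (v + w) => p.
  rewrite !scalerDr scalerN addrACA -scaleNr -(scalerDl p) -(scalerDl (u n)).
  have -> : (1 - a) / 2 + (1 + a) / 2 = 1 by field.
  by rewrite scale1r; congr (_ + _ *: _); field.
rewrite (le_trans (ler_normD _ _))// !normrZ !ger0_norm; [|lra..].
have -> : B = (1 - a) / 2 * B + (1 + a) / 2 * B by field.
by rewrite lerD// ler_wpM2l//; lra.
Qed.

(** A signed sum is the difference of two sums over disjoint sets of indices. *)
Lemma norm_multiplier_tail_le u N (eps : R) :
  (forall s : seq nat, uniq s -> all (leq N) s -> `|\sum_(l <- s) u l| <= eps) ->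
  forall lam n, (forall l, `|lam l| <= 1) ->
    `|\sum_(N <= l < n) lam l *: u l| <= 2 * eps.
Proof.
move=> H lam n lam1.
rewrite big_geq_mkord big_mkcond.
have -> : \sum_(i < n) (if (N <= i)%N then lam i *: u i else 0) =
    0 + \sum_(0 <= l < n) lam l *: (if (N <= l)%N then u l else 0).
  rewrite add0r big_mkord; apply: eq_bigr => i _; case: ifP => //.
  by rewrite scaler0.
apply: norm_sum_multiplier_le => // e e1; rewrite add0r.
rewrite (bigID (fun l => e l == 1))/= mulr2n mulrDl mul1r.
have pick (p : pred nat) : `|\sum_(0 <= l < n | p l) (if (N <= l)%N then u l else 0)| <= eps.
  rewrite -big_mkcondr -big_filter; apply: H.
    by rewrite filter_uniq// iota_uniq.
  by apply/allP => l; rewrite mem_filter => /andP[/andP[]].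
rewrite (le_trans (ler_normD _ _))// lerD//.
  under eq_bigr => l /eqP -> do rewrite scale1r.
  exact: pick.
have -> : \sum_(0 <= l < n | e l != 1) e l *: (if (N <= l)%N then u l else 0) =
    - \sum_(0 <= l < n | e l != 1) (if (N <= l)%N then u l else 0).
  rewrite -sumrN; apply: eq_bigr => l; have [->|->] := e1 l; first by rewrite eqxx.
  by rewrite scaleN1r.
by rewrite normrN; exact: pick.
Qed.

Lemma unconditional_multiplier_tail u (eps : R) :
  unconditionally_convergent u -> 0 < eps ->
  exists N, forall lam n, (forall l, `|lam l| <= 1) ->
    `|\sum_(N <= l < n) lam l *: u l| <= eps.
Proof.
move=> uu eps0.
have [N NP] := unconditional_finite_sums uu (divr_gt0 eps0 (ltr0n R 2)).
exists N => lam n lam1; have := norm_multiplier_tail_le NP n lam1.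
by rewrite mulrC divfK ?pnatr_eq0.
Qed.

Lemma cvg_multiplier u lam : unconditionally_convergent u ->
  (forall l, `|lam l| <= 1) -> cvgn (series (fun l => lam l *: u l)).
Proof.
move=> uu lam1; apply/cauchy_cvgP/cauchy_seriesP => eps eps0.
have [N NP] := unconditional_multiplier_tail uu (divr_gt0 eps0 (ltr0n R 2)).
exists ([set n | (N <= n)%N], setT).
  by split; [exists N|exact: filterT].
move=> [n m] [/= Nn _].
have -> : \sum_(n <= k < m) lam k *: u k =
    \sum_(N <= k < m) (if (n <= k)%N then lam k else 0) *: u k.
  rewrite !big_geq_mkord [in LHS]big_mkcond [in RHS]big_mkcond/=.
  apply: eq_bigr => i _; case: (leqP n i) => ni; first by rewrite (leq_trans Nn ni).
  by rewrite scale0r if_same.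
rewrite (le_lt_trans (NP _ _ _)) ?ltr_pdivrMr ?ltr_pMr ?ltr1n// => l.
by case: ifP => // _; rewrite normr0.
Qed.

End Multipliers.

(** * Expansions and bounds over all multipliers *)

Lemma cvg_sumr (R : realType) (V : normedModType R) (I : Type) (r : seq I)
    (f : I -> nat -> V) (l : I -> V) :
  (forall i, f i @ \oo --> l i) ->
  \sum_(i <- r) f i n @[n --> \oo] --> \sum_(i <- r) l i.
Proof.
move=> fl; elim: r => [|i r IH].
  by rewrite big_nil; under eq_fun do rewrite big_nil; exact: cvg_cst.
by rewrite big_cons; under eq_fun do rewrite big_cons; exact: cvgD.
Qed.

Lemma norm_cvg_le (R : realType) (V : normedModType R) (u : nat -> V) (x : V) (M : R) :
  u @ \oo --> x -> (forall n, `|u n| <= M) -> `|x| <= M.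
Proof.
move=> /cvg_norm ux uM; rewrite -(cvg_lim (@norm_hausdorff _ _) ux).
by apply: limr_le; [by apply/cvg_ex; exists `|x| |exact: nearW].
Qed.

Section Basis.
Variables (R : realType) (X : completeNormedModType R) (d : nat -> X).
Implicit Types (c lam : nat -> R) (x y : X) (M : R).

(** [M] bounds, over all multipliers in [-1, 1] and all partial sums, the norm
    of the modified expansion.  Stated as a predicate on [M], it can be handled
    before the least such bound is known to be finite. *)
Definition multiplier_bound c M := forall lam n, (forall l, `|lam l| <= 1) ->
  `|\sum_(0 <= l < n) (lam l * c l) *: d l| <= M.

Lemma multiplier_boundD c c' M M' :
  multiplier_bound c M -> multiplier_bound c' M' ->
  multiplier_bound (fun l => c l + c' l) (M + M').
Proof.
move=> cM cM' lam n lam1.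
under eq_bigr do rewrite mulrDr scalerDl.
by rewrite big_split (le_trans (ler_normD _ _))// lerD ?cM ?cM'.
Qed.

Lemma multiplier_boundZ (t : R) c M :
  multiplier_bound c M -> multiplier_bound (fun l => t * c l) (`|t| * M).
Proof.
move=> cM lam n lam1.
under eq_bigr do rewrite mulrCA -scalerA.
by rewrite -scaler_sumr normrZ ler_wpM2l// cM.
Qed.

Lemma multiplier_bound_coef c M l : multiplier_bound c M ->
  `|c l| * `|d l| <= M.
Proof.
move=> /(_ (fun m => (m == l)%:R) l.+1); rewrite big_nat_recr//= eqxx mul1r.
rewrite big_nat_cond big1 => [|i /andP[/andP[_ il] _]]; last first.
  by rewrite (ltn_eqF il) mul0r scale0r.
by rewrite add0r normrZ; apply=> m; case: eqP; rewrite ?normr1 ?normr0.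
Qed.

Lemma expansionD c c' x y : expansion d c x -> expansion d c' y ->
  expansion d (fun l => c l + c' l) (x + y).
Proof.
rewrite /expansion => cx cy.
have -> : series (fun l => (c l + c' l) *: d l) =
    series (fun l => c l *: d l) \+ series (fun l => c' l *: d l).
  by apply/funext => n; rewrite !seriesEnat/= -big_split; under eq_bigr do rewrite scalerDl.
exact: cvgD.
Qed.

Lemma expansionZ (t : R) c x : expansion d c x ->
  expansion d (fun l => t * c l) (t *: x).
Proof.
rewrite /expansion => cx.
have -> : series (fun l => (t * c l) *: d l) =
    (fun n => t *: series (fun l => c l *: d l) n).
  by apply/funext => n; rewrite !seriesEnat/= scaler_sumr; under eq_bigr do rewrite -scalerA.
exact: cvgZr.
Qed.

Lemma expansionB c c' x y : expansion d c x -> expansion d c' y ->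
  expansion d (fun l => c l - c' l) (x - y).
Proof.
move=> cx /(@expansionZ (-1) _ _) cy; have := expansionD cx cy.
by rewrite scaleN1r; under eq_fun do rewrite mulN1r.
Qed.

Lemma expansion_sum k (c : 'I_k -> nat -> R) (x : 'I_k -> X) :
  (forall i, expansion d (c i) (x i)) ->
  expansion d (fun l => \sum_i c i l) (\sum_i x i).
Proof.
rewrite /expansion => cx.
have -> : series (fun l => (\sum_i c i l) *: d l) =
    (fun n => \sum_i series (fun l => c i l *: d l) n).
  apply/funext => n; rewrite seriesEnat/= exchange_big/=.
  by apply: eq_bigr => i _; rewrite scaler_suml.
exact: cvg_sumr.
Qed.

Lemma expansion0 : expansion d (fun=> 0) 0.
Proof.
apply: cvg_near_cst; apply: nearW => n.
by rewrite seriesEnat/= big1// => l _; rewrite scale0r.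
Qed.

Lemma expansion_unique c x y : expansion d c x -> expansion d c y -> x = y.
Proof. by move=> cx cy; exact: cvg_unique cx cy. Qed.

Lemma expansion_finite c n : expansion d (fun l => \1_(`I_n) l * c l)
  (\sum_(0 <= l < n) c l *: d l).
Proof.
apply: cvg_near_cst; exists n => // m /= nm; rewrite seriesEnat/=.
rewrite (big_cat_nat (n := n))//= -[RHS]addr0; congr (_ + _).
  by apply: eq_big_nat => l /andP[_ ln]; rewrite indicE mem_set ?mul1r.
rewrite big_nat_cond big1// => l /andP[/andP[nl _] _].
by rewrite indicE memNset ?mul0r ?scale0r//= ltnNge nl.
Qed.

(** * The coordinates of a Schauder basis *)

Hypothesis dB : schauder_basis d.

Definition coord x := sval (cid (dB x)).

Lemma coordP x : expansion d (coord x) x.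
Proof. by rewrite /coord; case: cid => c []. Qed.

Lemma coordE c x : expansion d c x -> coord x = c.
Proof. by rewrite /coord; case: cid => c' [_ /=]; apply. Qed.

Lemma coordD x y : coord (x + y) = (fun l => coord x l + coord y l).
Proof. by apply: coordE; apply: expansionD; exact: coordP. Qed.

Lemma coordB x y : coord (x - y) = (fun l => coord x l - coord y l).
Proof. by apply: coordE; apply: expansionB; exact: coordP. Qed.

Lemma coordZ (t : R) x : coord (t *: x) = (fun l => t * coord x l).
Proof. by apply: coordE; apply: expansionZ; exact: coordP. Qed.

Lemma coord0 : coord 0 = (fun=> 0).
Proof. by apply: coordE; exact: expansion0. Qed.

(** Otherwise the coefficient at [l] would be arbitrary. *)
Lemma basis_neq0 l : d l != 0.
Proof.
apply/eqP => dl0.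
have : expansion d (fun m => (m == l)%:R) 0.
  rewrite /expansion; have -> : series (fun m => (m == l)%:R *: d m) = cst 0.
    apply/funext => n; rewrite seriesEnat/= big1// => m _.
    by case: eqP => [->|_]; rewrite ?dl0 ?scaler0 ?scale0r.
  exact: cvg_cst.
move/coordE/(congr1 (fun c => c l)); rewrite coord0 eqxx => /esym/eqP.
by rewrite oner_eq0.
Qed.

(** A sequence with limit [x] that is Cauchy for the least multiplier bound also
    converges to [x] for that bound: its coefficients converge, and their limits
    are the coefficients of [x] because partial sums converge uniformly along
    the sequence. *)
Lemma multiplier_bound_lim (x_ : nat -> X) x (r : nat -> R) :
  x_ @ \oo --> x -> r @ \oo --> (0 : R) ->
  (forall j m, (j <= m)%N -> multiplier_bound (coord (x_ m - x_ j)) (r j)) ->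
  multiplier_bound (coord (x - x_ 0%N)) (r 0%N).
Proof.
move=> xx r0 xr.
have cvgc l : cvgn (fun m => coord (x_ m) l).
  apply/cauchy_cvgP/cauchy_exP => e e0.
  have dl0 : 0 < `|d l| by rewrite normr_gt0 basis_neq0.
  have /cvgrPdist_lt/(_ (e * `|d l|))[|J _ /(_ J (leqnn J))] := r0.
    by rewrite mulr_gt0.
  rewrite /= sub0r normrN => /(le_lt_trans (ler_norm _)) rJ.
  exists (coord (x_ J) l); exists J => // m /= Jm.
  have := multiplier_bound_coef l (xr _ _ Jm).
  move=> /le_lt_trans/(_ rJ); rewrite coordB ltr_pM2r// distrC; exact.
pose c l := limn (fun m => coord (x_ m) l).
have cj j : multiplier_bound (fun l => c l - coord (x_ j) l) (r j).
  move=> lam n lam1.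
  pose f m := \sum_(0 <= l < n) (lam l * (coord (x_ m) l - coord (x_ j) l)) *: d l.
  have fc : f m @[m --> \oo] -->
      \sum_(0 <= l < n) (lam l * (c l - coord (x_ j) l)) *: d l.
    rewrite /f; apply: cvg_sumr => l; apply: cvgZl; apply: cvgMr.
    by apply: cvgB; [exact: cvgc|exact: cvg_cst].
  have /cvg_norm fn := fc.
  rewrite -(cvg_lim (@norm_hausdorff _ _) fn).
  apply: limr_le; first by apply/cvg_ex; eexists; exact: fn.
  exists j => // m /= jm; have := xr j m jm lam n lam1.
  by rewrite coordB.
(* One index [J] with [r J] small controls all partial sums at once. *)
suff cx : expansion d c x by rewrite coordB (coordE cx).
apply/cvgrPdist_le => e e0.
have e3 : 0 < e / 3 by rewrite divr_gt0.
have [J [xJ rJ]] : exists J, `|x - x_ J| <= e / 3 /\ r J <= e / 3.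
  have /cvgrPdist_le/(_ _ e3) := xx; have /cvgrPdist_le/(_ _ e3) := r0.
  move=> [A _ HA] [B _ HB]; exists (maxn A B); split.
    by apply: HB; rewrite /= leq_maxr.
  have := HA (maxn A B) (leq_maxl _ _); rewrite /= sub0r normrN.
  exact: le_trans (ler_norm _).
have /cvgrPdist_le/(_ _ e3)[N _ NP] := @coordP (x_ J).
exists N => // n Nn; have /= := NP n Nn.
set S := series _ n => xS; set T := series _ n.
have ST : `|S - T| <= e / 3.
  apply: le_trans rJ; have := cj J (fun=> 1) n (fun=> _).
  rewrite distrC /S /T !seriesEnat/= -sumrB.
  under eq_bigr do rewrite mul1r scalerBl.
  by apply=> l; rewrite normr1.
have -> : x - T = (x - x_ J) + (x_ J - S) + (S - T).
  by rewrite [x - x_ J + _]addrA subrK addrA subrK.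
rewrite (le_trans (ler_normD _ _))//; have := ler_normD (x - x_ J) (x_ J - S).
by move: xJ xS ST; lra.
Qed.

(** * Finiteness of the unconditional constant *)

Hypothesis dU : forall c, cvgn (series (fun l => c l *: d l)) ->
  unconditionally_convergent (fun l => c l *: d l).

Lemma coord_unconditional x :
  unconditionally_convergent (fun l => coord x l *: d l).
Proof. by apply: dU; apply/cvg_ex; exists x; exact: coordP. Qed.

Lemma multiplier_bound_exists x : exists M, multiplier_bound (coord x) M.
Proof.
have [N NP] := unconditional_multiplier_tail (@coord_unconditional x) (@ltr01 R).
exists (\sum_(0 <= l < N) `|coord x l *: d l| + 1) => lam n lam1.
have head p : (p <= N)%N -> `|\sum_(0 <= l < p) (lam l * coord x l) *: d l| <=
    \sum_(0 <= l < N) `|coord x l *: d l|.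
  move=> pN; rewrite [leRHS](big_cat_nat (n := p))//= (le_trans (ler_norm_sum _ _ _))//.
  rewrite -[leLHS]addr0 lerD ?sumr_ge0//; apply: ler_sum => l _.
  by rewrite -scalerA normrZ ler_piMl.
have [nN|/ltnW Nn] := leqP n N; first by rewrite (le_trans (head _ nN))// lerDl.
rewrite (big_cat_nat (n := N))//= (le_trans (ler_normD _ _))// lerD ?head//.
by under eq_bigr do rewrite -scalerA; exact: NP.
Qed.

(** Baire's theorem: the sets of vectors with multiplier bound [n] cover the
    space, so that one of them is dense in a ball; differences of vectors of
    this ball make the set dense in a ball around the origin, and scaling gives
    the remaining vectors. *)
Lemma multiplier_bound_dense : exists2 C : R, 0 <= C & forall h (delta : R),
  0 < delta -> exists2 a, multiplier_bound (coord a) (C * `|h|) & `|h - a| <= delta.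
Proof.
pose A n := [set x | multiplier_bound (coord x) n%:R].
have [n [x0 [r r0 ball_r]]] : exists n : nat, exists x0, exists2 r : R, 0 < r &
    forall y, `|x0 - y| < r -> closure (A n) y.
  have : ~ forall n, dense (~` closure (A n)).
    move=> H; have /Baire dI n : open (~` closure (A n)) /\ dense (~` closure (A n)).
      by split=> //; exact/closed_openC/closed_closure.
    have [x [_ Hx]] := dI setT (ex_intro _ 0 I) openT.
    have [M MP] := multiplier_bound_exists x.
    apply: (Hx (Num.truncn M).+1 I); apply: subset_closure => lam n lam1.
    by rewrite (le_trans (MP lam n lam1))// ltW// truncnS_gt.
  move=> /existsNP[n /existsNP[U /not_implyP[ [x0 Ux0] /not_implyP[Uo UA]]]].
  have /nbhs_ballP[r /= r0 rU] := open_nbhs_nbhs (conj Uo Ux0).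
  exists n, x0, r => // y xy; apply: contrapT => nA.
  by apply: UA; exists y; split=> //; apply: rU; rewrite -ball_normE.
have approx y (delta : R) : `|x0 - y| < r -> 0 < delta ->
    exists2 a, A n a & `|y - a| < delta.
  move=> /ball_r Ay delta0.
  have [a [Aa ya]] := Ay _ (nbhsx_ballx y _ delta0).
  by exists a => //; move: ya; rewrite -ball_normE.
exists (n%:R * 2 / r) => [|h delta delta0].
  by rewrite divr_ge0 ?mulr_ge0// ltW.
have [->|h0] := eqVneq h 0.
  exists 0; last by rewrite subrr normr0 ltW.
  move=> lam m _; rewrite coord0 big1 ?normr0 ?mulr0// => l _.
  by rewrite mulr0 scale0r.
have hn0 : 0 < `|h| by rewrite normr_gt0.
(* The factor [t] moves [h] into the ball: [t *: h] has norm [r / 2]. *)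
pose t := r / 2 / `|h|.
have t0 : 0 < t by rewrite !divr_gt0.
have thr : `|t *: h| < r.
  rewrite normrZ gtr0_norm// /t divfK ?gt_eqF// ltr_pdivrMr// ltr_pMr// ltr1n//.
have td : 0 < t * delta by rewrite mulr_gt0.
have [u Au hu] : exists2 a, A n a & `|x0 + t *: h - a| < t * delta.
  by apply: approx => //; rewrite opprD addrA subrr sub0r normrN.
have [v Av hv] : exists2 a, A n a & `|x0 - t *: h - a| < t * delta.
  by apply: approx => //; rewrite opprB addrC subrK.
exists (t^-1 *: (2^-1 *: (u - v))).
  have -> : n%:R * 2 / r * `|h| = `|t^-1| * (`|2^-1| * (n%:R + `|-1| * n%:R)) :> R.
    rewrite normrN1 !ger0_norm ?invr_ge0 ?ltW// /t; field.
    by rewrite !gt_eqF.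
  rewrite -scaleN1r coordZ; apply: multiplier_boundZ.
  rewrite coordZ; apply: multiplier_boundZ.
  rewrite coordD; apply: multiplier_boundD => //.
  by rewrite coordZ; apply: multiplier_boundZ.
have -> : h - t^-1 *: (2^-1 *: (u - v)) =
    (t^-1 / 2) *: ((x0 + t *: h - u) - (x0 - t *: h - v)).
  have -> : (x0 + t *: h - u) - (x0 - t *: h - v) = (2 * t) *: h - (u - v).
    rewrite opprD addrACA -opprD [- (x0 - _)]opprB [x0 + _]addrC addrACA.
    by rewrite subrr addr0 mulr_natl mulr2n scalerDl.
  rewrite [RHS]scalerBr !scalerA (_ : t^-1 / 2 * (2 * t) = 1) ?scale1r//.
  by field; rewrite gt_eqF.
rewrite normrZ ger0_norm; last by rewrite divr_ge0// invr_ge0 ltW.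
have := ler_normB (x0 + t *: h - u) (x0 - t *: h - v).
move=> H; rewrite mulrAC ler_pdivrMr// ler_pdivrMl//.
by move: H hu hv; lra.
Qed.

(** Successive approximation: the multiplier norm is dominated by the given
    norm, since each vector is the limit of sums of approximations from
    [multiplier_bound_dense] whose multiplier bounds decrease geometrically. *)
Lemma multiplier_bound_linear :
  exists2 C : R, 0 <= C & forall x, multiplier_bound (coord x) (C * `|x|).
Proof.
have [C C0 CP] := multiplier_bound_dense.
exists (2 * C) => [|x]; first by rewrite mulr_ge0.
have [->|x0] := eqVneq x 0.
  move=> lam m _; rewrite coord0 big1 ?normr0 ?mulr0// => l _.
  by rewrite mulr0 scale0r.
set b := `|x|; have b0 : 0 < b by rewrite normr_gt0.
(* [h j] is the part of [x] left after [j] approximations, of norm at most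
   [b * w j]. *)
pose w j : R := (2^-1) ^+ j.
have w0 j : 0 < w j by rewrite exprn_gt0.
have wS j : w j.+1 = w j / 2 by rewrite /w exprSr.
have /choice[g gP] : forall p : nat * X, exists a,
    multiplier_bound (coord a) (C * `|p.2|) /\ `|p.2 - a| <= b * w p.1.+1.
  move=> [j h]; have [|a aM ha] := CP h (b * w j.+1); first exact: mulr_gt0.
  by exists a.
pose h := fix h j := if j is i.+1 then h i - g (i, h i) else x.
have hb j : `|h j| <= b * w j.
  by case: j => [|j]; [rewrite /w expr0 mulr1|exact: (gP (j, h j)).2].
pose x_ j := x - h j.
have -> : multiplier_bound (coord x) (2 * C * b) =
    multiplier_bound (coord (x - x_ 0%N)) (2 * C * b * w 0%N).
  by rewrite /x_ /= subrr subr0 /w expr0 mulr1.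
have wcvg : w @ \oo --> (0 : R) by apply: cvg_expr; rewrite ger0_norm// invf_lt1// ltr1n.
apply: (@multiplier_bound_lim x_ x (fun j => 2 * C * b * w j)).
- apply/cvgrPdist_le => e e0.
  have /cvgrPdist_le/(_ (e / b))[|J _ JP] := wcvg; first exact: divr_gt0.
  exists J => // j Jj; have := JP j Jj.
  rewrite /= sub0r normrN gtr0_norm// ler_pdivlMr// mulrC => wj.
  by rewrite /x_ subKr (le_trans (hb j)).
- by rewrite -[X in _ --> X](mulr0 (2 * C * b)); apply: cvgMr.
(* Geometric sum: the step from [p] to [p.+1] costs
   [C * b * w p = 2 * C * b * (w p - w p.+1)]. *)
move=> j m jm.
have : multiplier_bound (coord (x_ m - x_ j)) (2 * C * b * (w j - w m)).
  rewrite -(subnKC jm); elim: (m - j)%N => [|i IH].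
    move=> lam n _; rewrite addn0 !subrr mulr0 coord0 big1 ?normr0// => l _.
    by rewrite mulr0 scale0r.
  rewrite addnS; set p := (j + i)%N in IH *.
  have -> : x_ p.+1 - x_ j = (x_ p - x_ j) + g (p, h p).
    by rewrite [RHS]addrAC; congr (_ - _); rewrite /x_ /= opprB addrA addrAC.
  have -> : 2 * C * b * (w j - w p.+1) = 2 * C * b * (w j - w p) + C * (b * w p).
    by rewrite wS; field.
  rewrite coordD; refine (multiplier_boundD IH _) => lam n lam1.
  by rewrite (le_trans ((gP (p, h p)).1 lam n lam1))// ler_wpM2l//; exact: hb.
move=> H lam n lam1; rewrite (le_trans (H lam n lam1))//.
by apply: ler_wpM2l; [rewrite !mulr_ge0// ltW|rewrite gerBl ltW].
Qed.

Notation K := (unconditional_constant d).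

Local Lemma sign_mask_le1 (F : set nat) (e : nat -> R) l :
  (forall l, e l = 1 \/ e l = -1) -> `|\1_F l * e l| <= 1.
Proof.
move=> /(_ l) e1; rewrite normrM indicE.
by case: (l \in F); case: e1 => ->; rewrite ?normr1 ?normrN1 ?normr0 ?mulr1 ?mul0r.
Qed.

(** This makes the supremum defining the unconditional constant a genuine one:
    sign patterns and restrictions to sets of indices are multipliers. *)
Lemma unconditional_constant_ub (F : set nat) e x y :
  (forall l, e l = 1 \/ e l = -1) ->
  expansion d (fun l => \1_F l * e l * coord x l) y -> `|y| <= K * `|x|.
Proof.
move=> e1 xy.
have [x0|x0] := eqVneq x 0.
  have -> : y = 0.
    apply: expansion_unique xy _; rewrite x0 coord0.
    by under eq_fun do rewrite mulr0; exact: expansion0.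
  by rewrite x0 !normr0 mulr0.
have xn0 : 0 < `|x| by rewrite normr_gt0.
have [C C0 CP] := multiplier_bound_linear.
(* The supremum is over vectors [x] of norm 1, whence the rescaling. *)
rewrite -ler_pdivrMr//; apply: ub_le_sup.
  exists C => _ [F'] [e'] [c] [x'] [y'] [e1' cx' x1' cy' ->].
  apply: norm_cvg_le cy' _ => n; rewrite -(mulr1 C) -x1' -(coordE cx').
  by apply: CP => l; exact: sign_mask_le1.
exists F, e, (fun l => `|x|^-1 * coord x l), (`|x|^-1 *: x), (`|x|^-1 *: y).
split=> //.
- by apply: expansionZ; exact: coordP.
- by rewrite normrZ ger0_norm ?invr_ge0// mulVf// gt_eqF.
- by under eq_fun do rewrite mulrCA; exact: expansionZ.
- by rewrite normrZ ger0_norm ?invr_ge0// mulrC.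
Qed.

Lemma unconditional_constant_ge1 : 1 <= K.
Proof.
have d0 : 0 < `|d 0%N| by rewrite normr_gt0 basis_neq0.
rewrite -(ler_pM2r d0) mul1r.
apply: (@unconditional_constant_ub setT (fun=> 1)); first by left.
by under eq_fun do rewrite indicT !mul1r; exact: coordP.
Qed.

(** Signs are the extreme points of the multipliers in [-1, 1], so that the
    unconditional constant also bounds these. *)
Lemma multiplier_bound_constant x : multiplier_bound (coord x) (K * `|x|).
Proof.
move=> lam n lam1; under eq_bigr do rewrite -scalerA.
rewrite -[X in `|X|]add0r; apply: norm_sum_multiplier_le => // e e1.
rewrite add0r; under eq_bigr do rewrite scalerA.
apply: (@unconditional_constant_ub `I_n e) => //.
by under eq_fun do rewrite -mulrA; exact: expansion_finite.
Qed.

(** * Coefficients dominated by a finite sum of expansions *)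

(** Coefficients dominated by a sum of absolute values are combinations of the
    dominating coefficients by multipliers in [-1, 1]. *)
Lemma dominated_expansion k (q : nat -> R) (x : 'I_k -> X) :
  (forall l, `|q l| <= \sum_i `|coord (x i) l|) ->
  exists2 y, expansion d q y & `|y| <= K * norm_pow x.
Proof.
move=> qx; pose S l := \sum_i `|coord (x i) l|.
have S0 l : 0 <= S l by apply: sumr_ge0.
(* If [S l = 0] then [q l] and all [coord (x i) l] are zero, and so is
   [lam i l], as division by zero gives zero. *)
pose lam i l := Num.sg (coord (x i) l) * (q l / S l).
have lam1 i l : `|lam i l| <= 1.
  rewrite normrM (le_trans (ler_piMl _ _))//.
    by rewrite normr_sg; case: eqP; rewrite ?ler01.
  have [->|Sl0] := eqVneq (S l) 0; first by rewrite invr0 mulr0 normr0 ler01.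
  by rewrite normrM normfV (ger0_norm (S0 l)) ler_pdivrMr ?lt_def ?Sl0 ?S0// mul1r qx.
have qE : q = fun l => \sum_i lam i l * coord (x i) l.
  apply/funext => l; rewrite /lam.
  under eq_bigr do rewrite mulrAC -normrEsg.
  rewrite -mulr_suml -/(S l).
  have [Sl0|Sl0] := eqVneq (S l) 0; last by rewrite mulrCA divff// mulr1.
  by rewrite Sl0 mul0r; apply/eqP; rewrite -normr_le0 -Sl0 qx.
have /choice[y yP] i : exists y, expansion d (fun l => lam i l * coord (x i) l) y.
  apply/cvg_ex; have := cvg_multiplier (@coord_unconditional (x i)) (lam1 i).
  by under eq_fun do rewrite scalerA.
exists (\sum_i y i); first by rewrite qE; exact: expansion_sum.
rewrite (le_trans (ler_norm_sum _ _ _))// mulr_sumr; apply: ler_sum => i _.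
apply: norm_cvg_le (yP i) _ => n.
exact: multiplier_bound_constant.
Qed.

Lemma quantile_expansion_dist k (a : nat -> R) (x z : 'I_k -> X) qx qz :
  is_componentwise_quantile d a x qx -> is_componentwise_quantile d a z qz ->
  expansion d (fun l => quantile (a l) (fun i => coord (x i) l) -
                        quantile (a l) (fun i => coord (z i) l)) (qx - qz).
Proof.
move=> [c [cx qxP]] [c' [cz qzP]].
have cE : c = fun i => coord (x i) by apply/funext => i; exact/esym/coordE.
have c'E : c' = fun i => coord (z i) by apply/funext => i; exact/esym/coordE.
by rewrite {}cE {}c'E in qxP qzP; exact: expansionB.
Qed.

(** * Orthogonal bases *)

Lemma pythagoras (ip : {dot X for idfun}) c n :
  induces_norm ip -> orthogonal_family ip d ->
  `|\sum_(0 <= l < n) c l *: d l| ^+ 2 = \sum_(0 <= l < n) c l ^+ 2 * `|d l| ^+ 2.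
Proof.
move=> ipn orth.
have sq x : `|x| ^+ 2 = ip x x.
  rewrite ipn sqr_sqrtr//; have [->|/neq0_dnorm_gt0/ltW//] := eqVneq x 0.
  by rewrite linear0l.
elim: n => [|n IH]; first by rewrite !big_geq// normr0 expr0n.
rewrite !big_nat_recr//= [LHS]sq.
have o : ip (\sum_(0 <= l < n) c l *: d l) (c n *: d n) = 0.
  rewrite linear_sumlz big_nat_cond big1// => l /andP[/andP[_ ln] _].
  by rewrite linearZl_LR linearZr_LR/= orth ?ltn_eqF// !mulr0.
rewrite [LHS](@hnormDd R false idfun X ip _ _ o).
rewrite -[X in X + _ = _]sq -[X in _ + X = _]sq IH; congr (_ + _).
by rewrite normrZ exprMn real_normK ?num_real.
Qed.

(** The inequality holds for partial sums, where both sides are finite sums of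
    squares of coefficients, and passes to the limit. *)
Lemma quantile_dist_orthogonal k (a : nat -> R) (x z : 'I_k -> X) qx qz
    (ip : {dot X for idfun}) :
  induces_norm ip -> orthogonal_family ip d ->
  is_componentwise_quantile d a x qx -> is_componentwise_quantile d a z qz ->
  `|qx - qz| ^+ 2 <= \sum_i `|x i - z i| ^+ 2.
Proof.
move=> ipn orth qxP qzP; have qP := quantile_expansion_dist qxP qzP.
have sqr_cvg c y : expansion d c y ->
    `|series (fun l => c l *: d l) n| ^+ 2 @[n --> \oo] --> `|y| ^+ 2.
  move=> /cvg_norm yP; rewrite expr2; under eq_fun do rewrite expr2.
  exact: cvgM.
have xzP : (\sum_i `|series (fun l => coord (x i - z i) l *: d l) n| ^+ 2)
    @[n --> \oo] --> \sum_i `|x i - z i| ^+ 2.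
  by apply: (@cvg_sumr R R) => i; apply: sqr_cvg; exact: coordP.
apply: (ler_cvg_to (sqr_cvg _ _ qP) xzP); apply: nearW => n.
rewrite seriesEnat/= (pythagoras _ _ ipn orth).
under eq_bigr do rewrite seriesEnat/= (pythagoras _ _ ipn orth).
rewrite exchange_big/=; apply: ler_sum => l _; rewrite -mulr_suml.
rewrite ler_wpM2r ?sqr_ge0//; under eq_bigr do rewrite coordB.
exact: quantile_dist_sqr.
Qed.

End Basis.

Lemma sqrt_sum_sqr_le (R : realType) k (t : 'I_k -> R) : (forall i, 0 <= t i) ->
  Num.sqrt (\sum_i t i ^+ 2) <= \sum_i t i.
Proof.
move=> t0; have T0 : 0 <= \sum_i t i by exact: sumr_ge0.
rewrite -[leRHS]ger0_norm// -sqrtr_sqr ler_wsqrtr// [leRHS]expr2 mulr_suml.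
apply: ler_sum => i _; rewrite expr2 ler_wpM2l// (bigD1 i)//= lerDl.
exact: sumr_ge0.
Qed.

(** * Existence and Lipschitz continuity of the componentwise quantile *)

Theorem theorem4p4 (R : realType) (X : completeNormedModType R) (d : nat -> X)
    (d_basis : unconditional_schauder_basis d)
    (k : nat) (k_gt0 : (0 < k)%N)
    (a : nat -> R) (a01 : forall l, 0 < a l < 1) :
  [/\ forall x : 'I_k -> X, exists! q, is_componentwise_quantile d a x q,
      forall (x z : 'I_k -> X) (qx qz : X),
        is_componentwise_quantile d a x qx ->
        is_componentwise_quantile d a z qz ->
        `|qx - qz| <= unconditional_constant d ^+ 2 * norm_pow (x \- z)
    & forall ip : {dot X for idfun},
        induces_norm ip -> orthogonal_family ip d ->
        forall (x z : 'I_k -> X) (qx qz : X),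
          is_componentwise_quantile d a x qx ->
          is_componentwise_quantile d a z qz ->
          `|qx - qz| <= Num.sqrt (\sum_(i < k) `|x i - z i| ^+ 2)
                     <= norm_pow (x \- z) ].
Proof.
have [dB dU] := d_basis; split.
- move=> x; pose q l := quantile (a l) (fun i => coord dB (x i) l).
  have [l|y yP _] := @dominated_expansion _ _ _ dB dU k q x.
    rewrite -[q l]subr0 -{1}(@quantile0 R k (a l)).
    apply: le_trans (quantile_dist_sum _ _ _) _.
    by under eq_bigr do rewrite subr0.
  have yQ : is_componentwise_quantile d a x y.
    by exists (fun i => coord dB (x i)); split=> // i; exact: coordP.
  exists y; split=> // y' yQ'; apply/eqP; rewrite -subr_eq0; apply/eqP.
  apply: (expansion_unique (quantile_expansion_dist dB yQ yQ')).
  by under eq_fun do rewrite subrr; exact: expansion0.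
- move=> x z qx qz qxP qzP; have qP := quantile_expansion_dist dB qxP qzP.
  have [l|y yP yK] := @dominated_expansion _ _ _ dB dU k (fun l =>
      quantile (a l) (fun i => coord dB (x i) l) -
      quantile (a l) (fun i => coord dB (z i) l)) (x \- z).
    apply: le_trans (quantile_dist_sum _ _ _) _.
    by apply: ler_sum => i _; rewrite coordB.
  rewrite (expansion_unique qP yP) (le_trans yK)// ler_wpM2r ?sumr_ge0//.
  have K1 := unconditional_constant_ge1 dB dU.
  by rewrite ler_eXnr.
move=> ip ipn orth x z qx qz qxP qzP; apply/andP; split; last first.
  exact: sqrt_sum_sqr_le.
rewrite -[leLHS]ger0_norm// -sqrtr_sqr ler_wsqrtr//.
exact: (quantile_dist_orthogonal dB ipn orth qxP qzP).
Qed.
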